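(* Assume conditions (A1)–(A5) stated in the context, and assume $\tau\gamma^{-2}q=o(1)$ as $n\to\infty$. Let $\widehat{\boldsymbol\beta}(\lambda)$ be the calibrated CCCP estimator and $\widehat{\boldsymbol\beta}^{(o)}$ the oracle estimator. (1) For all $n$ sufficiently large, $$P\bigl(\widehat{\boldsymbol\beta}(\lambda)=\widehat{\boldsymbol\beta}^{(o)}\bigr)\ \ge\ 1-8p\exp\bigl(-n\tau^2\lambda^2/(8\sigma^2)\bigr).$$ (2) If in addition $n\tau^2\lambda^2\to\infty$ and $\log p=o(n\tau^2\lambda^2)$, then $P\bigl(\widehat{\boldsymbol\beta}(\lambda)=\widehat{\boldsymbol\beta}^{(o)}\bigr)\to 1$ as $n\to\infty$.
   Context: Model: for each $n$, $\mathbf y=\mathbf X\boldsymbol\beta^*+\boldsymbol\varepsilon$, where $\mathbf X$ is a nonrandom $n\times p$ matrix with columns $\mathbf x_{(1)},\dots,\mathbf x_{(p)}$ normalized so that $\mathbf x_{(j)}^T\mathbf x_{(j)}/n=1$, $\boldsymbol\beta^*\in\mathbb R^p$ is the unknown true parameter, and $\boldsymbol\varepsilon=(\varepsilon_1,\dots,\varepsilon_n)^T$. The quantities $p$ (which may greatly exceed $n$), $q,\lambda,\tau,\gamma,d_*,\mathbf X,\boldsymbol\beta^*$ may all depend on $n$. $A_0=\{j:\beta_j^*\ne0\}$, $q=|A_0|$, $d_*=\min\{|\beta_j^*|:\beta_j^*\neq0\}$. For an index set $A$, $\mathbf X_A$ is the submatrix of columns of $\mathbf X$ with index in $A$ and $\mathbf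 v_A$ the subvector of $\mathbf v$. $\|\cdot\|$ is the Euclidean norm, $\|\cdot\|_1$ the $L_1$ norm. The oracle estimator $\widehat{\boldsymbol\beta}^{(o)}$ has $\widehat{\boldsymbol\beta}^{(o)}_{A_0}$ equal to the least squares estimator from regressing $\mathbf y$ on $\mathbf X_{A_0}$, and all other components $0$. Penalty: $p_\lambda(|t|)=J_\lambda(|t|)+\lambda|t|$ with $J_\lambda(|\cdot|)$ a differentiable concave function; $\nabla J_\lambda(|t|)$ denotes the derivative of $t\mapsto J_\lambda(|t|)$ at $t$. The penalty is standardized so that $\dot p_\lambda(0+)=\lambda$, and for some constant $a_0>0$, $\dot p_\lambda(t)\le\lambda$ for $0<t<a_0\lambda$ and $\dot p_\lambda(t)=0$ for $t>a_0\lambda$. Calibrated CCCP estimator: with $$Q(\boldsymbol\beta\mid\boldsymbol\beta^{(k)},\lambda)=\tfrac1{2n}\|\mathbf y-\mathbf X\boldsymbol\beta\|^2+\sum_{j=1}^p\nabla J_\lambda(|\beta_j^{(k)}|)\beta_j+\lambda\sum_{j=1}^p|\beta_j|,$$ put $\boldsymbol\beta^{(0)}=\mathbf 0$, $\widehat{\boldsymbol\beta}^{(1)}(\lambda)=\arg\min_{\boldsymbol\beta}Q(\boldsymbol\beta\mid\boldsymbol\beta^{(0)},\tau\lambda)$, and $\widehat{\boldsymbol\beta}(\lambda)=\arg\min_{\boldsymbol\beta}Q(\boldsymbol\beta\mid\widehat{\boldsymbol\beta}^{(1)}(\lambda),\lambda)$, where $\lambda>0$, $\tau>0$. Conditions: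 (A1) There is a constant $C_1>0$ with $\lambda_{\min}(n^{-1}\mathbf X_{A_0}^T\mathbf X_{A_0})\ge C_1$ ($\lambda_{\min}$ = smallest eigenvalue). (A2) $\varepsilon_1,\dots,\varepsilon_n$ are i.i.d. mean zero sub-Gaussian with scale factor $0<\sigma<\infty$: $E[\exp(t\varepsilon_i)]\le e^{\sigma^2t^2/2}$ for all $t$. (A3) $p_\lambda(t)$ is increasing and concave on $[0,\infty)$ with continuous derivative $\dot p_\lambda(t)$ on $(0,\infty)$; it admits the decomposition $p_\lambda(|t|)=J_\lambda(|t|)+\lambda|t|$, where $J_\lambda(|\cdot|)$ is a differentiable concave function, with $\nabla J_\lambda(|t|)=-\lambda\,\mathrm{sign}(t)$ for $|t|>a\lambda$, where $a>1$ is a constant, and $|\nabla J_\lambda(|t|)|\le|t|$ for $|t|\le b\lambda$, where $b\le a$ is a positive constant. (A4) $\gamma=\min_{\boldsymbol\delta\neq0,\ \|\boldsymbol\delta_{A_0^c}\|_1\le3\|\boldsymbol\delta_{A_0}\|_1}\frac{\|\mathbf X\boldsymbol\delta\|}{\sqrt n\,\|\boldsymbol\delta_{A_0}\|}>0$. (A5) $\lambda=o(d_* )$ and $\tau=o(1)$. *)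

(* Defs.v *)
From HB Require Import structures.
From mathcomp Require Import all_boot all_order all_algebra.
From mathcomp Require Import all_classical all_reals all_analysis.

Set Implicit Arguments.
Unset Strict Implicit.
Unset Printing Implicit Defensive.

Import Order.TTheory GRing.Theory Num.Theory.
Import numFieldNormedType.Exports.

Local Open Scope classical_set_scope.
Local Open Scope ring_scope.

(* The library norm on matrices is the max norm, hence the explicit
   Euclidean and L1 norms. *)
Definition l2norm (R : realType) (m : nat) (v : 'cV[R]_m) : R :=
  Num.sqrt (\sum_i v i 0 ^+ 2).

Definition l1norm (R : realType) (m : nat) (v : 'cV[R]_m) : R :=
  \sum_i `|v i 0|.

Definition subcols (R : realType) (n p : nat) (A : {set 'I_p})
    (X : 'M[R]_(n, p)) : 'M[R]_(n, #|A|) :=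
  colsub (@enum_val _ (mem A)) X.

Definition subvec (R : realType) (p : nat) (A : {set 'I_p})
    (v : 'cV[R]_p) : 'cV[R]_#|A| :=
  rowsub (@enum_val _ (mem A)) v.

Definition is_argmin (R : realType) (V : Type) (f : V -> R) (v : V) : Prop :=
  forall w, f v <= f w.

(* For a symmetric matrix of positive size the set of eigenvalues is finite
   and nonempty, so [inf] is the minimum. *)
Definition lambda_min (R : realType) (m : nat) (M : 'M[R]_m) : R :=
  inf [set a | eigenvalue M a].

Section linear_model.
Context (R : realType) (n p : nat).
Implicit Types (X : 'M[R]_(n, p)) (beta delta : 'cV[R]_p) (y : 'cV[R]_n).

(* For n = 0 and p > 0 this fails, as x / 0 = 0: use it for n > 0 only. *)
Definition normalized_columns X : Prop :=
  forall j, ((col j X)^T *m col j X) 0 0 / n%:R = 1.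

Definition active_set beta : {set 'I_p} := [set j | beta j 0 != 0]%SET.

(* [dmin] and [re_const] are minima written as [inf]: over nonempty sets both
   are attained.  If [beta = 0] both sets are empty, the minima are undefined
   and [inf] returns 0; this case is ruled out by the hypothesis
   [0 < re_const]. *)
Definition dmin beta : R := inf [set `|beta j 0| | j in [set j | beta j 0 != 0]].

Definition re_const X beta : R :=
  let A0 := active_set beta in
  inf [set l2norm (X *m delta) / (Num.sqrt n%:R * l2norm (subvec A0 delta))
      | delta in [set delta : 'cV[R]_p | delta != 0 /\
          l1norm (subvec (~: A0) delta) <= 3 * l1norm (subvec A0 delta)]].

Definition is_oracle X y beta (b : 'cV[R]_p) : Prop :=
  let A0 := active_set beta in
  subvec (~: A0) b = 0 /\
  is_argmin (fun u : 'cV[R]_#|A0| => l2norm (y - subcols A0 X *m u) ^+ 2)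
            (subvec A0 b).

(* [J lam] is the map t |-> J_lam(t); [nablaJ J lam] is the derivative of
   t |-> J_lam(|t|). *)
Definition nablaJ (J : R -> R -> R) (lam : R) : R -> R :=
  derive1 (fun t : R => J lam `|t|).

Definition cccp_objective (J : R -> R -> R) X y (bk : 'cV[R]_p) (lam : R)
    (b : 'cV[R]_p) : R :=
  (2 * n%:R)^-1 * l2norm (y - X *m b) ^+ 2
  + \sum_j nablaJ J lam (bk j 0) * b j 0
  + lam * \sum_j `|b j 0|.

Definition is_calibrated_cccp (J : R -> R -> R) X y (tau lam : R)
    (b1 b : 'cV[R]_p) : Prop :=
  is_argmin (cccp_objective J X y 0 (tau * lam)) b1 /\
  is_argmin (cccp_objective J X y b1 lam) b.

End linear_model.

Section penalty.
Context (R : realType).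
Implicit Types (pen J : R -> R -> R).

Definition concave_on (D : set R) (f : R -> R) : Prop :=
  forall x y t : R, D x -> D y -> 0 <= t <= 1 ->
    t * f x + (1 - t) * f y <= f (t * x + (1 - t) * y).

Definition standardized_penalty pen (a0 : R) : Prop :=
  forall lam : R, 0 < lam ->
  [/\ derive1 (pen lam) t @[t --> 0^'+] --> lam,
      forall t : R, 0 < t -> t < a0 * lam -> derive1 (pen lam) t <= lam
    & forall t : R, a0 * lam < t -> derive1 (pen lam) t = 0].

Definition regular_penalty pen J (a b : R) : Prop :=
  [/\ 1 < a, 0 < b, b <= a
    & forall lam : R, 0 < lam ->
      [/\ forall s t : R, 0 <= s -> s <= t -> pen lam s <= pen lam t,
          concave_on `[0, +oo[ (pen lam),
          forall t : R, 0 < t -> derivable (pen lam) t 1 /\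
            {for t, continuous (derive1 (pen lam))},
          forall t : R, pen lam `|t| = J lam `|t| + lam * `|t|
        & [/\ concave_on setT (fun t => J lam `|t|),
              forall t : R, derivable (fun t => J lam `|t|) t 1,
              forall t : R, a * lam < `|t| -> nablaJ J lam t = - lam * Num.sg t
            & forall t : R, `|t| <= b * lam -> `|nablaJ J lam t| <= `|t|]]].

End penalty.

Section noise.
Context (d : measure_display) (T : measurableType d) (R : realType)
        (P : probability T R) (n : nat).
Implicit Types eps : 'I_n -> {RV P >-> R}.

Definition mutually_independent eps : Prop :=
  forall (I : {set 'I_n}) (B : 'I_n -> set R),
    (forall i, measurable (B i)) ->
    P (\bigcap_(i in [set` I]) (eps i @^-1` B i))
    = (\prod_(i in I) P (eps i @^-1` B i))%E.

Definition identically_distributed eps : Prop :=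
  forall (i j : 'I_n) (B : set R), measurable B ->
    distribution P (eps i) B = distribution P (eps j) B.

Definition iid_subgaussian eps (sigma : R) : Prop :=
  [/\ mutually_independent eps, identically_distributed eps,
      forall i, ('E_P[eps i] = 0)%E
    & forall i (t : R), ('M_P (eps i) t <= (expR (sigma ^+ 2 * t ^+ 2 / 2))%:E)%E].

Definition response (p : nat) (X : 'M[R]_(n, p)) (beta : 'cV[R]_p) eps
    (w : T) : 'cV[R]_n :=
  X *m beta + \col_i eps i w.

End noise.

(* Main.v *)
(** Let [e] be the noise vector and work on the event that [|x_j^T e| <= n tau
    lam / 2] for all columns [x_j] of [X]; a sub-Gaussian tail bound for each
    column and a union bound show that it fails with probability at most [2 p
    exp (- n tau^2 lam^2 / (8 sigma^2))]. On this event the rest is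
    deterministic. Write [kappa = tau q / gamma^2]. Since [nabla J (0) = 0],
    the first step is the lasso, so its error lies in the cone of (A4) and is
    at most [12 kappa lam] in each coordinate. The oracle error [u] is
    supported on [A0], hence also lies in the cone, and the normal equations
    bound [|u|_oo] by [kappa lam / 2] and [|X u|^2] by [n tau kappa lam^2 /
    4]. Once [tau] and [kappa] are small and [lam / d_*] is small, the linear
    term of the second step cancels the L1 penalty on [A0] and is at most [lam
    / 4] off [A0], where the gradient of the loss at the oracle is at most
    [lam / 2]: the oracle satisfies the optimality conditions strictly, hence
    is the only minimizer. *)

Require Import Defs.
From HB Require Import structures.
From mathcomp Require Import all_boot all_order all_algebra.
From mathcomp Require Import all_classical all_reals all_analysis.
From mathcomp Require Import measurable_realfun ring lra.

Set Implicit Arguments.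
Unset Strict Implicit.
Unset Printing Implicit Defensive.

Import Order.TTheory GRing.Theory Num.Theory.
Import numFieldNormedType.Exports.

Local Open Scope classical_set_scope.
Local Open Scope ring_scope.

(** * Deterministic analysis of the two steps *)

Section dot_product.
Context (R : realType) (m : nat).
Implicit Types u v : 'cV[R]_m.

Definition dotv u v : R := \sum_i u i 0 * v i 0.

Lemma dotvC u v : dotv u v = dotv v u.
Proof. by apply: eq_bigr => i _; rewrite mulrC. Qed.

Lemma dotvv_ge0 v : 0 <= dotv v v.
Proof. by apply: sumr_ge0 => i _; rewrite -expr2 sqr_ge0. Qed.

Lemma l2norm_sqr v : l2norm v ^+ 2 = dotv v v.
Proof.
rewrite /l2norm sqr_sqrtr; last by apply: sumr_ge0 => i _; rewrite sqr_ge0.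
by apply: eq_bigr => i _; rewrite expr2.
Qed.

Lemma dotvBr u v w : dotv u (v - w) = dotv u v - dotv u w.
Proof.
by rewrite /dotv -sumrB; apply: eq_bigr => i _; rewrite !mxE mulrBr.
Qed.

Lemma dotv_sub_sqr u v :
  dotv (u - v) (u - v) = dotv u u - 2 * dotv u v + dotv v v.
Proof.
rewrite dotvBr dotvC dotvBr [dotv (u - v) v]dotvC dotvBr [dotv v u]dotvC; ring.
Qed.

Lemma dotv_mulmx (p : nat) (X : 'M[R]_(m, p)) (r : 'cV[R]_m) (w : 'cV[R]_p) :
  dotv r (X *m w) = \sum_j w j 0 * (X^T *m r) j 0.
Proof.
rewrite /dotv; under eq_bigr do rewrite mxE mulr_sumr.
rewrite exchange_big; apply: eq_bigr => j _; rewrite mxE mulr_sumr.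
by apply: eq_bigr => i _; rewrite !mxE; ring.
Qed.

End dot_product.

(** Lagrange's identity: the nonnegative double sum of [(f i * g j - f j * g i) ^+ 2] is twice the
    gap between the two sides. *)
Lemma cauchy_schwarz_sum (R : realFieldType) (I : finType) (A : pred I)
    (f g : I -> R) :
  (\sum_(i in A) f i * g i) ^+ 2
  <= (\sum_(i in A) f i ^+ 2) * (\sum_(i in A) g i ^+ 2).
Proof.
have : 0 <= \sum_(i in A) \sum_(j in A) (f i * g j - f j * g i) ^+ 2.
  by apply: sumr_ge0 => i _; apply: sumr_ge0 => j _; exact: sqr_ge0.
have -> : \sum_(i in A) \sum_(j in A) (f i * g j - f j * g i) ^+ 2 =
    \sum_(i in A) \sum_(j in A) f i ^+ 2 * g j ^+ 2
    - 2 * (\sum_(i in A) \sum_(j in A) (f i * g i) * (f j * g j))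
    + \sum_(i in A) \sum_(j in A) g i ^+ 2 * f j ^+ 2.
  rewrite mulr_sumr -sumrB -big_split; apply: eq_bigr => i _ /=.
  rewrite mulr_sumr -sumrB -big_split; apply: eq_bigr => j _ /=; ring.
rewrite -!big_distrlr /=; lra.
Qed.

Lemma dotv_le (R : realType) m (u v : 'cV[R]_m) :
  dotv u v ^+ 2 <= dotv u u * dotv v v.
Proof.
have := cauchy_schwarz_sum predT (u ^~ 0) (v ^~ 0).
by under [X in X * _]eq_bigr do rewrite expr2; under [X in _ * X]eq_bigr do rewrite expr2.
Qed.

Section subvectors.
Context (R : realType) (p : nat) (A : {set 'I_p}).
Implicit Types v : 'cV[R]_p.

Lemma l1norm_subvec v : l1norm (subvec A v) = \sum_(j in A) `|v j 0|.
Proof.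
rewrite /l1norm [RHS]big_enum_val; apply: eq_bigr => i _.
by rewrite /subvec mxE.
Qed.

Lemma l2norm_subvec v : l2norm (subvec A v) ^+ 2 = \sum_(j in A) v j 0 ^+ 2.
Proof.
rewrite /l2norm sqr_sqrtr; last by apply: sumr_ge0 => i _; rewrite sqr_ge0.
by rewrite [RHS]big_enum_val; apply: eq_bigr => i _; rewrite /subvec mxE.
Qed.

Lemma subcols_mul_subvec n (X : 'M[R]_(n, p)) v :
  (forall j, j \notin A -> v j 0 = 0) -> subcols A X *m subvec A v = X *m v.
Proof.
move=> v0; apply/matrixP => i k; rewrite !mxE (bigID (mem A)) /=.
rewrite [X in _ + X]big1 => [|j jA]; last by rewrite ord1 v0 ?mulr0.
rewrite addr0 [RHS]big_enum_val.
by apply: eq_bigr => j _; rewrite /subvec !mxE.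
Qed.

Lemma l1norm_sqr_le v :
  (\sum_(j in A) `|v j 0|) ^+ 2 <= #|A|%:R * \sum_(j in A) v j 0 ^+ 2.
Proof.
have := cauchy_schwarz_sum (mem A) (fun=> 1) (fun j => `|v j 0|).
under eq_bigr do rewrite mul1r.
under [X in _ <= X * _]eq_bigr do rewrite expr1n.
under [X in _ <= _ * X]eq_bigr do rewrite real_normK ?num_real//.
by rewrite sumr_const.
Qed.

End subvectors.

(** * The restricted eigenvalue bound and the normal equations of the oracle *)

Section design.
Context (R : realType) (n p : nat).
Variables (X : 'M[R]_(n, p)) (beta : 'cV[R]_p).
Hypothesis n_gt0 : (0 < n)%N.
Let A := active_set beta.
Let gamma := re_const X beta.
Let nR_gt0 : 0 < n%:R :> R. Proof. by rewrite ltr0n. Qed.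

(** Squared and cleared of denominators, the definition of [gamma] as an infimum also covers a [v]
    that vanishes on [A], where the quotient has denominator zero. *)
Lemma re_const_cone (v : 'cV[R]_p) : 0 < gamma ->
  \sum_(j in ~: A) `|v j 0| <= 3 * \sum_(j in A) `|v j 0| ->
  gamma ^+ 2 * (n%:R * \sum_(j in A) v j 0 ^+ 2) <= dotv (X *m v) (X *m v).
Proof.
move=> g0 cone; rewrite -l2norm_subvec -l2norm_sqr.
have [->|v0] := eqVneq (l2norm (subvec A v)) 0.
  by rewrite expr0n /= !mulr0 sqr_ge0.
have l2_ge0 m (w : 'cV[R]_m) : 0 <= l2norm w by exact: sqrtr_ge0.
have vA_gt0 : 0 < l2norm (subvec A v) by rewrite lt_neqAle eq_sym v0 l2_ge0.
have sn_gt0 : 0 < Num.sqrt n%:R :> R by rewrite sqrtr_gt0.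
have : gamma <= l2norm (X *m v) / (Num.sqrt n%:R * l2norm (subvec A v)).
  apply: ge_inf.
    by exists 0 => _ [w _ <-]; rewrite divr_ge0 ?mulr_ge0 ?sqrtr_ge0.
  exists v => //; split; last by rewrite !l1norm_subvec.
  apply: contra_neq v0 => ->; rewrite /l2norm big1 ?sqrtr0// => i _.
  by rewrite !mxE expr0n.
rewrite ler_pdivlMr ?mulr_gt0// => h.
have -> : gamma ^+ 2 * (n%:R * l2norm (subvec A v) ^+ 2)
    = (gamma * (Num.sqrt n%:R * l2norm (subvec A v))) ^+ 2.
  by rewrite [RHS]exprMn [(_ * l2norm _) ^+ 2]exprMn (sqr_sqrtr (ler0n R n)).
by rewrite ler_sqr ?nnegrE ?l2_ge0// !mulr_ge0 ?l2_ge0 ?ltW.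
Qed.

Lemma active_setC j : j \notin A -> beta j 0 = 0.
Proof. by rewrite inE negbK => /eqP. Qed.

Lemma dmin_le j : j \in A -> dmin beta <= `|beta j 0|.
Proof.
rewrite inE => bj; apply: ge_inf; last by exists j.
by exists 0 => _ [k _ <-].
Qed.

Hypothesis X_norm : normalized_columns X.

Lemma dotv_col j : dotv (col j X) (col j X) = n%:R.
Proof.
have := X_norm j; rewrite !mxE => /(congr1 ( *%R^~ n%:R)).
rewrite divfK ?lt0r_neq0// mul1r => <-.
by apply: eq_bigr => i _; rewrite !mxE.
Qed.

Lemma tr_mul_col (r : 'cV[R]_n) j : (X^T *m r) j 0 = dotv r (col j X).
Proof. by rewrite mxE; apply: eq_bigr => i _; rewrite !mxE mulrC. Qed.

Lemma oracle_normal_eq y b : is_oracle X y beta b ->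
  (forall j, j \notin A -> b j 0 = 0) /\
  (forall j, j \in A -> (X^T *m (y - X *m b)) j 0 = 0).
Proof.
rewrite /is_oracle -/A => -[bC bmin].
have b0 j : j \notin A -> b j 0 = 0.
  move=> jA; have := l1norm_subvec (~: A) b.
  rewrite bC /l1norm big1 => [|i _]; last by rewrite mxE normr0.
  move=> /esym/eqP; rewrite psumr_eq0 => [/allP/(_ j)|i _ //].
  by rewrite mem_index_enum inE jA normr_eq0 => /(_ isT)/eqP.
split=> // j jA; rewrite tr_mul_col.
(* [t] is the exact line minimizer along coordinate [j], because [col j X] has squared norm [n].
   Moving by [t] lowers the loss by [n t^2], so minimality forces [t = 0]. *)
set r := y - X *m b; set t := dotv r (col j X) / n%:R.
have := bmin (subvec A (b + t *: delta_mx j 0)).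
rewrite !subcols_mul_subvec //; last first.
  move=> k kA; rewrite !mxE b0// (_ : k == j = false) ?mulr0 ?addr0//.
  by apply: contraNF kA => /eqP ->.
rewrite mulmxDr -scalemxAr -colE opprD addrA -/r !l2norm_sqr.
have -> : dotv (r - t *: col j X) (r - t *: col j X) =
    dotv r r - 2 * (t * dotv r (col j X)) + t ^+ 2 * dotv (col j X) (col j X).
  rewrite dotv_sub_sqr; congr (_ - 2 * _ + _); rewrite /dotv mulr_sumr;
    by apply: eq_bigr => i _; rewrite !mxE; ring.
rewrite dotv_col (_ : dotv r (col j X) = t * n%:R); last first.
  by rewrite /t divfK ?lt0r_neq0.
move=> h; have : t ^+ 2 * n%:R <= 0 by lra.
rewrite pmulr_lle0// => t2; have : t = 0.
  by apply/eqP; rewrite -sqrf_eq0 eq_le t2 sqr_ge0.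
by move=> ->; rewrite mul0r.
Qed.

Lemma oracle_linear : 0 < gamma ->
  exists L : 'M[R]_(p, n), forall y b, is_oracle X y beta b -> b = L *m y.
Proof.
(* [M b = D X^T y] encodes both the normal equations on the active set and the
   vanishing of [b] off it. *)
move=> g0; pose D : 'M[R]_p := diag_mx (\row_j (j \in A)%:R).
have DE m (M : 'M[R]_(p, m)) i k : (D *m M) i k = (i \in A)%:R * M i k.
  by rewrite mul_diag_mx !mxE.
have addE (u v w : 'cV[R]_p) i : (u + (v - w)) i 0 = u i 0 + (v i 0 - w i 0).
  by rewrite !mxE.
pose M := D *m (X^T *m X) + (1%:M - D).
(* A kernel vector [w] vanishes off [A] and has [X^T X w = 0] on [A], so [X w = 0]. It lies
   trivially in the cone, and positivity of [gamma] makes it vanish on [A] too. *)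
have Munit : M \in unitmx.
  rewrite -unitmx_tr -row_free_unit; apply: inj_row_free => v vM.
  have {}vM : M *m v^T = 0.
    by rewrite -[M]trmxK -trmx_mul vM trmx0.
  set w := v^T in vM.
  have Mw i : (i \in A)%:R * (X^T *m (X *m w)) i 0 + (1 - (i \in A)%:R) * w i 0 = 0.
    have := congr1 (fun N : 'cV[R]_p => N i 0) vM.
    by rewrite /M mulmxDl mulmxBl mul1mx -!mulmxA addE !DE [in RHS]mxE => <-; ring.
  have w0 j : j \notin A -> w j 0 = 0.
    by move=> jA; have := Mw j; rewrite (negbTE jA) mul0r add0r subr0 mul1r.
  have g0j j : j \in A -> (X^T *m (X *m w)) j 0 = 0.
    by move=> jA; have := Mw j; rewrite jA mul1r subrr mul0r addr0.
  have Xw0 : dotv (X *m w) (X *m w) = 0.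
    rewrite dotv_mulmx big1// => j _.
    by have [/g0j ->|/w0 ->] := boolP (j \in A); rewrite ?mulr0 ?mul0r.
  have cone : \sum_(j in ~: A) `|w j 0| <= 3 * \sum_(j in A) `|w j 0|.
    rewrite big1 => [|j]; last by rewrite inE => /w0 ->; rewrite normr0.
    by rewrite mulr_ge0 ?sumr_ge0.
  have := re_const_cone g0 cone; rewrite Xw0 pmulr_rle0 ?exprn_gt0//.
  rewrite pmulr_rle0// => s0.
  have /eqP : \sum_(j in A) w j 0 ^+ 2 = 0.
    by apply/eqP; rewrite eq_le s0 sumr_ge0// => i _; rewrite sqr_ge0.
  rewrite psumr_eq0 => [/allP wA|i _]; last by rewrite sqr_ge0.
  apply: trmx_inj; rewrite trmx0 -/w; apply/colP => j; rewrite [RHS]mxE.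
  have [jA|/w0 //] := boolP (j \in A).
  by have := wA j; rewrite mem_index_enum jA sqrf_eq0 => /(_ isT)/eqP.
exists (invmx M *m (D *m X^T)) => y b /oracle_normal_eq [b0 bA].
rewrite -mulmxA -[LHS](mulKmx Munit); congr (_ *m _).
apply/colP => i; rewrite mulmxDl mulmxBl mul1mx -!mulmxA.
rewrite addE !DE; have [iA|iA] := boolP (i \in A).
  rewrite !mul1r subrr addr0; have := bA _ iA.
  by rewrite mulmxBr => /eqP; rewrite !mxE subr_eq0 => /eqP ->.
by rewrite !mul0r subr0 add0r b0.
Qed.

End design.

(** * Estimation errors and uniqueness when all noise correlations are small *)

Section noise_event.
Context (R : realType) (n p : nat).
Variables (X : 'M[R]_(n, p)) (beta : 'cV[R]_p).
Hypothesis n_gt0 : (0 < n)%N.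
Hypothesis X_norm : normalized_columns X.
Let A := active_set beta.
Let gamma := re_const X beta.
Hypothesis gamma_gt0 : 0 < gamma.
Let nR_gt0 : 0 < n%:R :> R. Proof. by rewrite ltr0n. Qed.

(** With [s] the L1 norm on [A], Cauchy-Schwarz and the cone bound give [gamma^2 s^2 <= #|A| c s],
    and one factor [s] cancels. It serves the first step ([c = 3 tau lam]), the oracle
    ([c = tau lam / 2]) and uniqueness ([c = 0]). *)
Lemma cone_l1_le (v : 'cV[R]_p) (c : R) : 0 <= c ->
  \sum_(j in ~: A) `|v j 0| <= 3 * \sum_(j in A) `|v j 0| ->
  dotv (X *m v) (X *m v) <= n%:R * (c * \sum_(j in A) `|v j 0|) ->
  \sum_(j in A) `|v j 0| <= c * (gamma ^- 2 * #|A|%:R).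
Proof.
move=> c0 cone; have := re_const_cone n_gt0 gamma_gt0 cone.
have := l1norm_sqr_le A v; rewrite -/A -/gamma.
have : 0 <= \sum_(j in A) `|v j 0| by exact: sumr_ge0.
move: (\sum_(j in A) `|v j 0|) (\sum_(j in A) v j 0 ^+ 2) (dotv _ _) => s s2 D.
rewrite le_eqVlt => /predU1P[<- _ _ _|s_gt0 ss2 s2D Ds].
  by rewrite !mulr_ge0 ?ler0n// invr_ge0 sqr_ge0.
have g2 : 0 < gamma ^+ 2 by rewrite exprn_gt0.
rewrite mulrA [c * _]mulrC -mulrA [leRHS]mulrC ler_pdivlMr//.
rewrite -(ler_pM2l s_gt0) -(ler_pM2l nR_gt0).
have h : #|A|%:R * (gamma ^+ 2 * (n%:R * s2)) <= #|A|%:R * (n%:R * (c * s)).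
  by rewrite ler_wpM2l ?ler0n// (le_trans s2D).
have h' : gamma ^+ 2 * n%:R * s ^+ 2 <= gamma ^+ 2 * n%:R * (#|A|%:R * s2).
  by rewrite ler_wpM2l// mulr_ge0 ?ler0n ?ltW.
nra.
Qed.

Variables (lam tau : R) (e : 'cV[R]_n).
Hypotheses (lam_gt0 : 0 < lam) (tau_gt0 : 0 < tau).
Hypothesis e_small : forall j, `|(X^T *m e) j 0| <= n%:R * tau * lam / 2.
Let y := X *m beta + e.
Let kappa := tau * gamma ^- 2 * #|A|%:R.
Let kappa_ge0 : 0 <= kappa.
Proof. by rewrite !mulr_ge0 ?ler0n ?invr_ge0 ?sqr_ge0 ?ltW. Qed.

Lemma sum_splitC (f : 'I_p -> R) :
  \sum_j f j = \sum_(j in A) f j + \sum_(j in ~: A) f j.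
Proof.
by rewrite (bigID (mem A)) /=; congr (_ + _); apply: eq_bigl => j; rewrite finset.in_setC.
Qed.

Lemma noise_dotv_le (v : 'cV[R]_p) :
  dotv e (X *m v) <= n%:R * tau * lam / 2 * \sum_j `|v j 0|.
Proof.
rewrite dotv_mulmx mulr_sumr; apply: ler_sum => j _.
rewrite (le_trans (ler_norm _))// normrM mulrC ler_wpM2r//.
Qed.

Lemma residualE b : y - X *m b = e - X *m (b - beta).
Proof. by rewrite /y mulmxBr opprB addrA [e + _]addrC. Qed.

Lemma cccp_objectiveE J bk mu b : cccp_objective J X y bk mu b =
  (2 * n%:R)^-1 * dotv (e - X *m (b - beta)) (e - X *m (b - beta))
  + \sum_j (nablaJ J mu (bk j 0) * b j 0 + mu * `|b j 0|).
Proof.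
rewrite /cccp_objective residualE l2norm_sqr -addrA; congr (_ + _).
by rewrite mulr_sumr -big_split.
Qed.

(** Comparison with [beta] gives [|X v|^2 <= n tau lam (3 |v_A|_1 - |v_(~: A)|_1)]. Nonnegativity of
    the left side yields the cone, and then [|v_A|_1 <= 3 kappa lam]. The whole L1 norm is at most
    four times as large, hence 12. *)
Lemma lasso_error J b1 : nablaJ J (tau * lam) 0 = 0 ->
  is_argmin (cccp_objective J X y 0 (tau * lam)) b1 ->
  forall j, `|b1 j 0 - beta j 0| <= 12 * kappa * lam.
Proof.
move=> J0 /(_ beta); rewrite !cccp_objectiveE subrr mulmx0 subr0.
rewrite dotv_sub_sqr; set v := b1 - beta => hmin.
have vE j : v j 0 = b1 j 0 - beta j 0 by rewrite !mxE.
pose S := \sum_j (`|beta j 0| - `|b1 j 0|).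
have tl : 0 < tau * lam by rewrite mulr_gt0.
have hD : dotv (X *m v) (X *m v)
    <= 2 * dotv e (X *m v) + 2 * n%:R * (tau * lam * S).
  move: hmin; under eq_bigr do rewrite mxE J0 mul0r add0r.
  under [in leRHS]eq_bigr do rewrite mxE J0 mul0r add0r.
  rewrite -!mulr_sumr /S sumrB => hmin.
  rewrite -(ler_pM2l (_ : 0 < (2 * n%:R)^-1)) ?invr_gt0 ?mulr_gt0//.
  rewrite mulrDr mulKf ?gt_eqF ?mulr_gt0//; lra.
(* The reverse triangle inequality is used on [A]; off [A], [beta] vanishes and each term is exactly
   [- |v j 0|]. *)
have hS : S <= \sum_(j in A) `|v j 0| - \sum_(j in ~: A) `|v j 0|.
  rewrite /S sum_splitC -sumrN lerD//; apply: ler_sum => j jA.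
    by rewrite vE distrC lerB_dist.
  rewrite vE active_setC ?subr0 ?normr0 ?sub0r//.
  by move: jA; rewrite finset.in_setC.
have := noise_dotv_le v; rewrite sum_splitC.
have D0 := dotvv_ge0 (X *m v).
set D := dotv _ _ in hD D0 *; move: (dotv e _) hD => E hD.
have a0 : 0 <= \sum_(j in A) `|v j 0| by exact: sumr_ge0.
have t0 : 0 <= \sum_(j in ~: A) `|v j 0| by exact: sumr_ge0.
move=> hE j.
have hDat : D <= n%:R * (tau * lam) *
    (3 * \sum_(j in A) `|v j 0| - \sum_(j in ~: A) `|v j 0|).
  have : n%:R * (tau * lam) * S <= n%:R * (tau * lam) *
    (\sum_(j in A) `|v j 0| - \sum_(j in ~: A) `|v j 0|).
    by rewrite ler_wpM2l// mulr_ge0 ?ler0n ?ltW.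
  lra.
have cone : \sum_(j in ~: A) `|v j 0| <= 3 * \sum_(j in A) `|v j 0|.
  have := le_trans D0 hDat; rewrite pmulr_rge0 ?subr_ge0//.
  by rewrite mulr_gt0.
have aE : \sum_(j in A) `|v j 0| <= 3 * (tau * lam) * (gamma ^- 2 * #|A|%:R).
  apply: cone_l1_le => //; first by rewrite mulr_ge0 ?ltW.
  rewrite -/D (le_trans hDat)//.
  have : 0 <= n%:R * (tau * lam) * \sum_(j in ~: A) `|v j 0|.
    by rewrite mulr_ge0// mulr_ge0 ?ler0n// ltW.
  lra.
rewrite -vE (@le_trans _ _ (\sum_j `|v j 0|))//.
  by rewrite (bigD1 j)//= lerDl sumr_ge0.
rewrite sum_splitC /kappa; lra.
Qed.

(** The residual [e - X v] is orthogonal to the active columns and [v] is supported on [A], so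
    [|X v|^2] equals the inner product of [e] and [X v]. The noise bound and [cone_l1_le] then
    control [v]. The second bound is Cauchy-Schwarz against a column of squared norm [n], kept
    squared to avoid roots. *)
Lemma oracle_error b : is_oracle X y beta b ->
  [/\ forall j, `|b j 0 - beta j 0| <= kappa * lam / 2
    & forall j, dotv (X *m (b - beta)) (col j X) ^+ 2
                <= n%:R ^+ 2 * (tau * kappa * lam ^+ 2 / 4)].
Proof.
move=> /(oracle_normal_eq n_gt0 X_norm)[b0 bA].
set v := b - beta.
have vE j : v j 0 = b j 0 - beta j 0 by rewrite !mxE.
have v0 j : j \notin A -> v j 0 = 0.
  by move=> jA; rewrite vE b0// active_setC ?subrr.
have tl : 0 < tau * lam by rewrite mulr_gt0.
have vC : \sum_(j in ~: A) `|v j 0| = 0.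
  by rewrite big1// => j; rewrite finset.in_setC => /v0 ->; rewrite normr0.
have D_eq : dotv (X *m v) (X *m v) = dotv e (X *m v).
  apply/eqP; rewrite eq_sym -subr_eq0 dotvC -dotvBr dotvC dotv_mulmx.
  rewrite big1// => j _; rewrite -residualE.
  by have [/bA ->|/v0 ->] := boolP (j \in A); rewrite ?mulr0 ?mul0r.
have := noise_dotv_le v; rewrite -D_eq sum_splitC vC addr0 => hD.
have aE : \sum_(j in A) `|v j 0| <= tau * lam / 2 * (gamma ^- 2 * #|A|%:R).
  apply: cone_l1_le.
  - by rewrite divr_ge0// ltW.
  - by rewrite vC mulr_ge0 ?sumr_ge0.
  - by apply: le_trans hD _; rewrite le_eqVlt; apply/orP; left; apply/eqP; ring.
have aE' : \sum_(j in A) `|v j 0| <= kappa * lam / 2 by rewrite /kappa; lra.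
split=> j.
  rewrite -vE (@le_trans _ _ (\sum_j `|v j 0|))//.
    by rewrite (bigD1 j)//= lerDl sumr_ge0.
  by rewrite sum_splitC vC addr0.
apply: (le_trans (dotv_le _ _)); rewrite (dotv_col n_gt0 X_norm).
rewrite mulrC expr2 -mulrA ler_wpM2l ?ler0n//.
apply: le_trans hD _.
apply: (@le_trans _ _ (n%:R * tau * lam / 2 * (kappa * lam / 2))).
  by rewrite ler_wpM2l// divr_ge0// ltW// !mulr_gt0.
by rewrite le_eqVlt; apply/orP; left; apply/eqP; field.
Qed.

(** Off [A], [12 kappa <= b] puts the first-step estimate where [nablaJ] is at most [|t|] in
    absolute value. [48 kappa <= 1] makes the first-step error at most [lam / 4], and [2 tau <= 1]
    makes the noise correlations at most [n lam / 4]. The bound on [dmin] keeps active coordinates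
    of [b1] beyond [a lam]. *)
Lemma cccp_eq_oracle pen J a b b1 bhat bo :
  regular_penalty pen J a b ->
  12 * kappa <= b -> 48 * kappa <= 1 -> 2 * tau <= 1 ->
  (a + 1) * lam <= dmin beta ->
  is_calibrated_cccp J X y tau lam b1 bhat -> is_oracle X y beta bo ->
  bhat = bo.
Proof.
case=> a_gt1 b_gt0 ba /[dup] /(_ _ lam_gt0)[_ _ _ _ [_ _ J_far J_near]] Jreg.
move=> kb k1 t1 beta_min [b1min bmin] or_bo.
have J0 : nablaJ J (tau * lam) 0 = 0.
  have tl : 0 < tau * lam by rewrite mulr_gt0.
  have [_ _ _ _ [_ _ _ /(_ 0)]] := Jreg _ tl.
  by rewrite normr0 => /(_ (mulr_ge0 (ltW b_gt0) (ltW tl))); rewrite normr_le0 => /eqP.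
have b1E := lasso_error J0 b1min.
have [boE Xbo] := oracle_error or_bo.
have [bo0 boA] := oracle_normal_eq n_gt0 X_norm or_bo.
have kl : 48 * kappa * lam <= lam by rewrite -[leRHS]mul1r ler_wpM2r// ltW.
have alam : lam < a * lam by rewrite -[ltLHS]mul1r ltr_pM2r.
pose h j := nablaJ J lam (b1 j 0).
(* Both [b1] and [bo] are within [lam / 4] of [beta], so on [A] all three share their signs, and
   [b1] lies in the flat region of the penalty. *)
have hA j : j \in A -> h j = - lam * Num.sg (bo j 0).
  move=> jA; have bj := le_trans beta_min (dmin_le jA).
  have d1 : `|b1 j 0 - beta j 0| <= lam / 4 by apply: le_trans (b1E j) _; lra.
  have d2 : `|bo j 0 - beta j 0| <= lam / 4.
    by apply: le_trans (boE j) _; move: kl (mulr_ge0 kappa_ge0 (ltW lam_gt0)); lra.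
  have b1_far : a * lam < `|b1 j 0|.
    have := lerB_dist (beta j 0) (b1 j 0); rewrite [`|_ - b1 _ _|]distrC.
    move: alam d1 bj lam_gt0; rewrite mulrDl mul1r; lra.
  have {}bj : lam <= `|beta j 0|.
    by rewrite (le_trans _ bj)// mulrDl mul1r lerDr mulr_ge0 ?ltW// (lt_trans _ a_gt1).
  rewrite /h J_far//; congr (_ * _).
  move: d1 d2; rewrite !ler_norml => /andP[d1 d1'] /andP[d2 d2'].
  case: (ltrgt0P (beta j 0)) bj => bs bj.
  - by rewrite !gtr0_sg//; move: bj d1 d2 lam_gt0; lra.
  - by rewrite !ltr0_sg//; move: bj d1' d2' lam_gt0; lra.
  - by move: bj lam_gt0; lra.
have hC j : j \notin A -> `|h j| <= lam / 4.
  move=> jA; have := b1E j; rewrite (active_setC jA) subr0 => d1.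
  have : `|b1 j 0| <= b * lam by rewrite (le_trans d1)// ler_wpM2r// ltW.
  by move/J_near => /le_trans; apply; rewrite (le_trans d1)//; lra.
pose r := y - X *m bo; pose g j := (X^T *m r) j 0.
(* One [n lam / 4] comes from the noise and one from the oracle error, the latter since
   [tau kappa <= 1 / 4]. *)
have gC j : `|g j| <= n%:R * (lam / 2).
  have -> : g j = (X^T *m e) j 0 - dotv (X *m (bo - beta)) (col j X).
    rewrite /g /r residualE !tr_mul_col [in LHS]dotvC dotvBr.
    by congr (_ - _); exact: dotvC.
  rewrite (le_trans (ler_normB _ _))//.
  have : `|dotv (X *m (bo - beta)) (col j X)| <= n%:R * (lam / 4).
    have nl : 0 <= n%:R * (lam / 4) by rewrite mulr_ge0 ?ler0n ?divr_ge0 ?ltW.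
    rewrite -ler_sqr ?nnegrE// real_normK ?num_real//.
    rewrite (le_trans (Xbo j))// exprMn ler_wpM2l ?sqr_ge0//.
    rewrite [leRHS](_ : _ = (1 / 4) * lam ^+ 2 / 4); last by field.
    rewrite ler_wpM2r ?invr_ge0// ler_wpM2r ?sqr_ge0//.
    have : tau * kappa <= (1 / 2) * kappa by rewrite ler_wpM2r//; lra.
    by move: kappa_ge0; lra.
  have : n%:R * tau * lam / 2 <= n%:R * (lam / 4).
    rewrite -!mulrA ler_wpM2l ?ler0n//.
    have : tau * lam <= (1 / 2) * lam by rewrite ler_wpM2r ?(ltW lam_gt0)//; lra.
    by move: lam_gt0; lra.
  have := e_small j; lra.
set v := bhat - bo.
have vE j : v j 0 = bhat j 0 - bo j 0 by rewrite !mxE.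
(* The second-step objective at [bhat] minus its value at [bo] is
   [\sum_j t j + |X v|^2 / (2 n)], and every [t j] is nonnegative. *)
pose t j :=
  - (n%:R^-1 * (v j 0 * g j)) + h j * v j 0 + lam * (`|bhat j 0| - `|bo j 0|).
have tA j : j \in A -> 0 <= t j.
  move=> jA; rewrite /t /g boA// !mulr0 oppr0 add0r hA// vE.
  have -> : - lam * Num.sg (bo j 0) * (bhat j 0 - bo j 0) +
      lam * (`|bhat j 0| - `|bo j 0|) =
      lam * (`|bhat j 0| - Num.sg (bo j 0) * bhat j 0).
    by rewrite [`|bo j 0|]normrEsg; ring.
  rewrite mulr_ge0 ?(ltW lam_gt0)// subr_ge0 (le_trans (ler_norm _))// normrM.
  by rewrite ler_piMl// normr_sg; case: (_ != 0).
(* The slack is [lam - lam / 2 - lam / 4]: the L1 penalty minus the bounds on the loss gradient and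
   on [h j]. Its strict positivity later forces [v] to vanish off [A]. *)
have tC j : j \notin A -> lam / 4 * `|v j 0| <= t j.
  move=> jA; rewrite /t.
  have vb : v j 0 = bhat j 0 by rewrite vE bo0// subr0.
  rewrite bo0// normr0 subr0 vb.
  have h1 : h j * bhat j 0 >= - (lam / 4 * `|bhat j 0|).
    rewrite lerNl (le_trans (ler_norm _))// normrN normrM ler_wpM2r//; exact: hC.
  have h2 : n%:R^-1 * (bhat j 0 * g j) <= lam / 2 * `|bhat j 0|.
    rewrite ler_pdivrMl// (le_trans (ler_norm _))// normrM mulrC mulrA.
    by rewrite ler_wpM2r.
  lra.
have t_ge0 j : 0 <= t j.
  have [/tA //|/tC] := boolP (j \in A); apply: le_trans.
  by rewrite mulr_ge0// divr_ge0// ltW.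
have sum_le : \sum_j t j + (2 * n%:R)^-1 * dotv (X *m v) (X *m v) <= 0.
  have := bmin bo; rewrite !cccp_objectiveE -!residualE.
  have -> : y - X *m bhat = r - X *m v.
    by rewrite /r /v mulmxBr opprB addrA subrK.
  rewrite -/r dotv_sub_sqr dotv_mulmx -/r.
  have -> : \sum_j t j = - (n%:R^-1 * \sum_j v j 0 * g j)
      + \sum_j (h j * bhat j 0 + lam * `|bhat j 0|)
      - \sum_j (h j * bo j 0 + lam * `|bo j 0|).
    rewrite mulr_sumr -sumrN -big_split -sumrB; apply: eq_bigr => j _ /=.
    by rewrite /t vE; ring.
  rewrite -/(g _); set S1 := \sum_j _; set S2 := \sum_j _.
  have -> : (2 * n%:R)^-1 = n%:R^-1 / 2 :> R by rewrite invfM mulrC.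
  lra.
have st0 : 0 <= \sum_j t j by exact: sumr_ge0.
have D0 : 0 <= (2 * n%:R)^-1 * dotv (X *m v) (X *m v).
  by rewrite mulr_ge0 ?dotvv_ge0// invr_ge0 mulr_ge0.
have t0 j : t j = 0.
  have /eqP : \sum_j t j = 0 by lra.
  by rewrite psumr_eq0 => [/allP/(_ j)|//]; rewrite mem_index_enum => /(_ isT)/eqP.
have Xv0 : dotv (X *m v) (X *m v) = 0.
  have /eqP : (2 * n%:R)^-1 * dotv (X *m v) (X *m v) = 0 by lra.
  by rewrite mulf_eq0 invr_eq0 mulf_eq0 pnatr_eq0 (gt_eqF nR_gt0) => /eqP.
have v0 j : j \notin A -> v j 0 = 0.
  move=> /tC; rewrite t0 pmulr_rle0 ?divr_gt0// normr_le0 => /eqP //.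
(* On [A] the terms [t j] have no slack; there uniqueness comes from [X v = 0] and the cone
   condition. *)
have vA0 : \sum_(j in A) `|v j 0| <= 0 * (gamma ^- 2 * #|A|%:R).
  apply: cone_l1_le => //; last by rewrite Xv0 mul0r mulr0.
  rewrite big1 ?mulr_ge0 ?sumr_ge0// => j.
  by rewrite finset.in_setC => /v0 ->; rewrite normr0.
apply/eqP; rewrite -subr_eq0; apply/eqP/colP => j; rewrite -/v [RHS]mxE.
have [jA|/v0 //] := boolP (j \in A).
rewrite mul0r in vA0; apply/eqP; rewrite -normr_le0; apply: le_trans vA0.
by rewrite (bigD1 j)//= lerDl sumr_ge0.
Qed.

End noise_event.

(** * Sub-Gaussian noise *)

Section independence.
Context (d : measure_display) (T : measurableType d) (R : realType).
Local Open Scope ereal_scope.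
Import HBNNSimple.

(** Monotone convergence along simple functions increasing to [f], with the weight [g] left
    untouched. *)
Lemma cvg_integral_nnsfun_approx (P : {measure set T -> \bar R})
    (g : T -> R) (X : {mfun T >-> R}) (f : R -> R)
    (mf : measurable_fun setT (EFin \o f)) :
  (forall w, 0 <= g w)%R -> measurable_fun setT g -> (forall x, 0 <= f x)%R ->
  \int[P]_w (g w * nnsfun_approx measurableT mf k (X w))%:E @[k --> \oo]
  --> \int[P]_w (g w * f (X w))%:E.
Proof.
move=> g0 mg f0; pose G k w := (g w * nnsfun_approx measurableT mf k (X w))%:E.
have -> : \int[P]_w (g w * f (X w))%:E = \int[P]_w limn (G ^~ w).
  apply: eq_integral => w _; apply/esym/cvg_lim => //.
  rewrite /G EFinM; under eq_fun do rewrite EFinM; apply: cvgeZl => //.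
  by apply: (@cvg_nnsfun_approx _ _ _ _ measurableT _ mf) => // x _; rewrite lee_fin.
apply: cvg_monotone_convergence => //.
- move=> k; apply/measurable_EFinP; apply: measurable_funM => //.
  exact: measurableT_comp.
- by move=> k w _; rewrite lee_fin mulr_ge0.
- move=> w _ k l kl; rewrite lee_fin ler_wpM2l//.
  by have /lefP := @nd_nnsfun_approx _ _ _ _ measurableT _ mf k l kl; apply.
Qed.

Lemma ge0_integral_nnsfun_comp (P : {measure set T -> \bar R})
    (g : T -> R) (X : {mfun T >-> R}) (f : {nnsfun R >-> R}) :
  (forall w, 0 <= g w)%R -> measurable_fun setT g ->
  \int[P]_w (g w * f (X w))%:E =
  \sum_(y \in range f)
    (y%:E * \int[P]_w (g w * \1_(X @^-1` (f @^-1` [set y])) w)%:E).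
Proof.
move=> g0 mg.
have mX y : measurable (X @^-1` (f @^-1` [set y])).
  by rewrite -[X @^-1` _]setTI; apply: measurable_funPT.
have mf1 y : measurable_fun setT (fun w => \1_(f @^-1` [set y]) (X w) : R).
  exact: (@measurableT_comp _ _ _ _ _ _ (\1_(f @^-1` [set y]) : R -> R)).
under eq_integral.
  move=> w _; rewrite EFinM fimfunE -fsumEFin// ge0_mule_fsumr; last first.
    by move=> y; rewrite EFinM nnfun_muleindic_ge0.
  over.
rewrite ge0_integral_fsum//; last 2 first.
- move=> y; under eq_fun do rewrite -EFinM.
  apply/measurable_EFinP/measurable_funM => //.
  exact: measurable_funM.
- by move=> y w _; apply: mule_ge0; [rewrite lee_fin | rewrite EFinM nnfun_muleindic_ge0].
apply: eq_fsbigr => y; rewrite inE => -[x _ <-].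
rewrite -ge0_integralZl ?lee_fin//.
- by apply: eq_integral => w _; rewrite -!EFinM mulrCA.
- by apply/measurable_EFinP/measurable_funM.
- by move=> w _; rewrite lee_fin mulr_ge0// indicE.
Qed.

(** Factorization passes from indicators to simple functions by linearity, and to [f] by uniqueness
    of limits. In use, [g] is the product of the other factors and [c] the product of their
    expectations. *)
Lemma ge0_integral_factor (P : probability T R) (g : T -> R)
    (X : {RV P >-> R}) (c : \bar R) (f : R -> R) :
  (forall w, 0 <= g w)%R -> measurable_fun setT g -> 0 <= c -> c \is a fin_num ->
  (forall B, measurable B ->
    \int[P]_w (g w * \1_(X @^-1` B) w)%:E = c * P (X @^-1` B)) ->
  measurable_fun setT f -> (forall x, 0 <= f x)%R ->
  \int[P]_w (g w * f (X w))%:E = c * \int[P]_w (f (X w))%:E.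
Proof.
move=> g0 mg c0 cfin gX mf f0.
have mX (B : set R) : measurable B -> measurable (X @^-1` B).
  by move=> mB; rewrite -[X @^-1` _]setTI; apply: measurable_funPT.
have mEf : measurable_fun setT (EFin \o f) by exact/measurable_EFinP.
have := @cvg_integral_nnsfun_approx P g X f mEf g0 mg f0.
have nn k : \int[P]_w (g w * nnsfun_approx measurableT mEf k (X w))%:E =
    c * \int[P]_w (1 * nnsfun_approx measurableT mEf k (X w))%:E.
  rewrite (ge0_integral_nnsfun_comp _ _ _ g0)//.
  rewrite (@ge0_integral_nnsfun_comp _ (cst 1%R))// ge0_mule_fsumr; last first.
    (* A negative [y] is not a value of a nonnegative simple function: its level set is empty and
       its term is 0. *)
    move=> y; have [y0|y0] := ltP y 0%R; last first.
      by rewrite mule_ge0// integral_ge0// => w _; rewrite lee_fin mulr_ge0// indicE.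
    rewrite preimage_nnfun0// preimage_set0.
    by under eq_integral do rewrite indic0 mulr0; rewrite integral0 mule0.
  apply: eq_fsbigr => y _; rewrite muleCA gX//; congr (_ * (_ * _)).
  under eq_integral do rewrite mul1r.
  by rewrite integral_indic// ?setIT//; exact: mX.
under eq_fun do rewrite nn.
move=> h; have := @cvg_integral_nnsfun_approx P (cst 1%R) X f mEf (fun=> ler01) (measurable_cst _) f0.
move=> /(cvgeZl cfin) /(cvg_unique _ h) ->//.
by under eq_integral do rewrite mul1r.
Qed.

End independence.

(** * Tails of linear combinations of the noise *)

Section subgaussian.
Context (d : measure_display) (T : measurableType d) (R : realType)
  (P : probability T R) (n : nat).
Implicit Types eps : 'I_n -> {RV P >-> R}.
Local Open Scope ereal_scope.

Lemma integral_prod_independent eps (f : 'I_n -> R -> R) :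
  mutually_independent eps ->
  (forall i, measurable_fun setT (f i)) -> (forall i x, 0 <= f i x)%R ->
  (forall i, \int[P]_w (f i (eps i w))%:E \is a fin_num) ->
  \int[P]_w (\prod_i f i (eps i w))%:E = \prod_i \int[P]_w (f i (eps i w))%:E.
Proof.
(* [s] lists the coordinates at which [f i] need not be an indicator; a
   coordinate is freed by [ge0_integral_factor]. *)
move=> ind.
have mX i (B : set R) : measurable B -> measurable (eps i @^-1` B).
  by move=> mB; rewrite -[_ @^-1` _]setTI; apply: measurable_funPT.
suff H (s : seq 'I_n) : forall f : 'I_n -> R -> R,
    (forall i, measurable_fun setT (f i)) -> (forall i x, 0 <= f i x)%R ->
    (forall i, \int[P]_w (f i (eps i w))%:E \is a fin_num) ->
    (forall i, i \notin s -> exists2 B, measurable B & f i = \1_B) ->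
    \int[P]_w (\prod_i f i (eps i w))%:E
    = \prod_i \int[P]_w (f i (eps i w))%:E.
  move=> mf f0 ffin; apply: (H (index_enum 'I_n)) => // i.
  by rewrite mem_index_enum.
elim: s => [|i s IH] {}f mf f0 ffin fB.
  (* Base case: every factor is an indicator, so the product is the indicator of an intersection and
     independence applies directly. *)
  have /choice[B BE] i : exists B, measurable B /\ f i = \1_B.
    by have [//|B mB ->] := fB i; exists B.
  have mB i : measurable (B i) by case: (BE i).
  have fE i w : f i (eps i w) = \1_(eps i @^-1` B i) w by case: (BE i) => _ ->.
  have := ind [set: 'I_n]%SET B mB.
  under eq_bigl do rewrite finset.in_setT.
  have -> : \prod_i P (eps i @^-1` B i) = \prod_i \int[P]_w (f i (eps i w))%:E.
    apply: eq_bigr => i _; under [RHS]eq_integral do rewrite fE.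
    by rewrite integral_indic ?setIT//; exact: mX.
  move=> <-; set E := \bigcap_(i in _) _.
  have mE : measurable E by apply: fin_bigcap_measurable => // i _; exact: mX.
  rewrite -[RHS](_ : \int[P]_w (\1_E w)%:E = _); last by rewrite integral_indic ?setIT.
  apply: eq_integral => w _; congr EFin; rewrite indicE.
  have [Ew|Ew] := boolP (w \in E).
    apply: big1 => i _; rewrite fE indicE mem_set//.
    by move/set_mem : Ew => /(_ i); apply; rewrite /= finset.in_setT.
  have [i Bi] : exists i, ~ (eps i @^-1` B i) w.
    apply/existsNP => h; move/negP : Ew; apply; apply/mem_set => i _; exact: h.
  by rewrite (bigD1 i)//= fE indicE memNset// mul0r.
pose c := \prod_(j | j != i) \int[P]_w (f j (eps j w))%:E.
pose g w := (\prod_(j | j != i) f j (eps j w))%R.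
rewrite (bigD1 i)//= muleC -/c.
have gE w : (\prod_j f j (eps j w) = g w * f i (eps i w))%R.
  by rewrite (bigD1 i)//= mulrC.
under eq_integral do rewrite gE.
apply: ge0_integral_factor => //.
- by move=> w; rewrite prodr_ge0.
- rewrite /g; under eq_fun do rewrite -big_filter.
  by apply: measurable_prod => j _; exact: measurableT_comp.
- by apply: prode_ge0 => j _; apply: integral_ge0 => w _; rewrite lee_fin.
- exact: prode_fin_num.
(* With factor [i] replaced by an indicator, the induction hypothesis for the shorter list [s]
   applies. *)
move=> B mB; pose f' j := if j == i then \1_B else f j.
have f'i : f' i = \1_B by rewrite /f' eqxx.
have f'j j : j != i -> f' j = f j by rewrite /f' => /negbTE ->.
have f'B : \int[P]_w (f' i (eps i w))%:E = P (eps i @^-1` B).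
  by rewrite f'i -[in RHS](setIT (_ @^-1` _)) -integral_indic//; exact: mX.
have -> : \int[P]_w (g w * \1_(eps i @^-1` B) w)%:E =
    \int[P]_w (\prod_j f' j (eps j w))%:E.
  apply: eq_integral => w _; congr EFin.
  rewrite (bigD1 i)//= f'i mulrC; congr (_ * _)%R.
  by apply: eq_bigr => j ji; rewrite f'j.
rewrite IH.
- rewrite (bigD1 i)//= f'B muleC; congr (_ * _).
  by apply: eq_bigr => j ji; rewrite f'j.
- move=> j; have [->|ji] := eqVneq j i; first by rewrite f'i; exact: measurable_indic.
  by rewrite f'j.
- move=> j x; have [->|ji] := eqVneq j i; first by rewrite f'i indicE.
  by rewrite f'j.
- move=> j; have [->|ji] := eqVneq j i; first by rewrite f'B fin_num_measure//; exact: mX.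
  by under eq_integral do rewrite f'j//.
- move=> j js; have [->|ji] := eqVneq j i; first by exists B.
  by rewrite f'j//; apply: fB; rewrite inE negb_or ji.
Qed.

Variables (eps : 'I_n -> {RV P >-> R}) (sigma : R).
Hypotheses (sigma_gt0 : (0 < sigma)%R) (eps_sg : iid_subgaussian eps sigma).

Lemma mmt_gen_fun_linear (c : 'I_n -> R) (t : R) :
  \int[P]_w (expR (t * \sum_i c i * eps i w))%:E
  <= (expR (sigma ^+ 2 * t ^+ 2 / 2 * \sum_i c i ^+ 2))%:E.
Proof.
have [ind _ _ mgf] := eps_sg.
pose f i x := expR (t * c i * x).
have mf i : measurable_fun setT (f i).
  by apply: measurableT_comp => //; exact: measurable_funM.
have f_le i : \int[P]_w (f i (eps i w))%:E
    <= (expR (sigma ^+ 2 * t ^+ 2 / 2 * c i ^+ 2))%:E.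
  have := mgf i (t * c i)%R; rewrite /mmt_gen_fun unlock.
  have -> : (sigma ^+ 2 * (t * c i) ^+ 2 / 2 = sigma ^+ 2 * t ^+ 2 / 2 * c i ^+ 2)%R.
    by rewrite exprMn; ring.
  apply: le_trans; rewrite le_eqVlt; apply/orP; left; apply/eqP.
  by apply: eq_integral => w _; rewrite /f /= mulrC.
have f_ge0 i : 0 <= \int[P]_w (f i (eps i w))%:E.
  by apply: integral_ge0 => w _; rewrite lee_fin expR_ge0.
have -> : \int[P]_w (expR (t * \sum_i c i * eps i w))%:E
    = \int[P]_w (\prod_i f i (eps i w))%:E.
  apply: eq_integral => w _; rewrite mulr_sumr expR_sum; congr EFin.
  by apply: eq_bigr => i _; rewrite /f mulrA.
rewrite integral_prod_independent//.
- rewrite mulr_sumr expR_sum -prodEFin.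
  (* Nonnegativity is carried along, since multiplying extended-real inequalities requires it. *)
  pose K (x y : \bar R) := 0 <= x /\ x <= y.
  suff [] : K (\prod_i \int[P]_w (f i (eps i w))%:E)
      (\prod_i (expR (sigma ^+ 2 * t ^+ 2 / 2 * c i ^+ 2))%:E) by [].
  elim/big_ind2: _ => [|x1 y1 x2 y2 [? ?] [? ?]|i _]; split=> //.
    exact: mule_ge0.
  exact: lee_pmul.
- by move=> i x; exact: expR_ge0.
- by move=> i; rewrite ge0_fin_numE// (le_lt_trans (f_le i))// ltry.
Qed.

Lemma measurable_linear_eps (c : 'I_n -> R) :
  measurable_fun setT (fun w => \sum_i c i * eps i w)%R.
Proof. by apply: measurable_sum => i; exact: measurable_funM. Qed.

Lemma subgaussian_upper_tail (c : 'I_n -> R) (s : R) :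
  (0 < s)%R -> (0 < \sum_i c i ^+ 2)%R ->
  P [set w | s <= \sum_i c i * eps i w]%R
  <= (expR (- s ^+ 2 / (2 * sigma ^+ 2 * \sum_i c i ^+ 2)))%:E.
Proof.
set V := (\sum_i c i ^+ 2)%R => s0 V0.
pose S : {RV P >-> R} := mfun_Sub (mem_set (measurable_linear_eps c)).
(* The minimizer of the Chernoff exponent [sigma^2 t^2 V / 2 - t s]. *)
pose t := (s / (sigma ^+ 2 * V))%R.
have s2V : (0 < sigma ^+ 2 * V)%R by rewrite mulr_gt0// exprn_gt0.
have t0 : (0 < t)%R by rewrite divr_gt0.
have := chernoff S s t0; rewrite /mmt_gen_fun unlock => /le_trans; apply.
apply: le_trans (_ : _ <= (expR (sigma ^+ 2 * t ^+ 2 / 2 * V))%:E * (expR (- (t * s)))%:E) _.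
  rewrite lee_wpmul2r ?lee_fin ?expR_ge0//.
  have := mmt_gen_fun_linear c t; apply: le_trans.
  rewrite le_eqVlt; apply/orP; left; apply/eqP.
  by apply: eq_integral => w _ /=; rewrite mulrC.
rewrite -EFinM -expRD lee_fin ler_expR le_eqVlt; apply/orP; left; apply/eqP.
by rewrite /t; field; rewrite !gt_eqF.
Qed.

Lemma subgaussian_tail (c : 'I_n -> R) (s : R) :
  (0 < s)%R -> (0 < \sum_i c i ^+ 2)%R ->
  P [set w | s <= `|\sum_i c i * eps i w|]%R
  <= (2 * expR (- s ^+ 2 / (2 * sigma ^+ 2 * \sum_i c i ^+ 2)))%:E.
Proof.
move=> s0 V0.
have Nc : (\sum_i (- c i) ^+ 2 = \sum_i c i ^+ 2)%R.
  by apply: eq_bigr => i _; rewrite sqrrN.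
have tail1 := subgaussian_upper_tail s0 V0.
have := @subgaussian_upper_tail (fun i => - c i)%R s s0; rewrite Nc => /(_ V0) tail2.
have mtail (b : 'I_n -> R) : measurable [set w | s <= \sum_i b i * eps i w]%R.
  rewrite -[X in measurable X]setTI.
  by apply: measurable_fun_le => //; exact: measurable_linear_eps.
have -> : [set w | s <= `|\sum_i c i * eps i w|]%R =
    [set w | s <= \sum_i c i * eps i w]%R
    `|` [set w | s <= \sum_i (- c i) * eps i w]%R.
  apply/seteqP; split => w /=; rewrite ler_normr -sumrN;
    under [X in _ || (_ <= X)%R]eq_bigr do rewrite -mulNr; by move/orP.
rewrite (le_trans (measureU2 _ (mtail _) (mtail _)))// mulr2n mulrDl mul1r EFinD leeD//.
Qed.

End subgaussian.

(** * Probability of recovering the oracle *)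

Section fixed_sample_size.
Context (d : measure_display) (T : measurableType d) (R : realType)
  (P : probability T R) (n p : nat).
Variables (X : 'M[R]_(n, p)) (beta : 'cV[R]_p) (eps : 'I_n -> {RV P >-> R}).
Variables (sigma : R).
Hypotheses (n_gt0 : (0 < n)%N) (X_norm : normalized_columns X).
Hypotheses (sigma_gt0 : 0 < sigma) (eps_sg : iid_subgaussian eps sigma).

(** A union bound over columns, each with [\sum_i X i j ^+ 2 = n]; measurability is carried through
    the same induction. *)
Lemma large_noise_prob (s : R) : 0 < s ->
  let E := \big[setU/set0]_j [set w | s <= `|\sum_i X i j * eps i w|] in
  measurable E /\
  (P E <= (2 * p%:R * expR (- s ^+ 2 / (2 * sigma ^+ 2 * n%:R)))%:E)%E.
Proof.
move=> s0 E; pose tail := 2 * expR (- s ^+ 2 / (2 * sigma ^+ 2 * n%:R)).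
have colsq j : \sum_i X i j ^+ 2 = n%:R.
  rewrite -(dotv_col n_gt0 X_norm j); apply: eq_bigr => i _.
  by rewrite !mxE expr2.
have -> : (2 * p%:R * expR (- s ^+ 2 / (2 * sigma ^+ 2 * n%:R)))%:E
    = (\sum_(j < p) tail%:E)%E.
  rewrite sumEFin sumr_const card_ord -[in RHS](mulr_natr tail) /tail.
  by congr EFin; ring.
rewrite /E; elim/big_ind2: _ => [|A x B y [mA Ax] [mB By]|j _].
- by rewrite measure0.
- by split; [exact: measurableU | rewrite (le_trans (measureU2 _ _ _))// leeD].
- split.
    rewrite -[X in measurable X]setTI; apply: measurable_fun_le => //.
    by apply: measurableT_comp => //; exact: measurable_linear_eps.
  rewrite /tail -(colsq j); apply: (subgaussian_tail sigma_gt0 eps_sg) => //.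
  by rewrite colsq ltr0n.
Qed.

(** By [oracle_linear] the oracle is a fixed matrix times the response, so its coordinates are
    measurable, and the event is a finite intersection of coordinatewise equalities. *)
Lemma measurable_eq_oracle (bhat bo : T -> 'cV[R]_p) :
  0 < re_const X beta ->
  (forall j, measurable_fun setT (fun w => bhat w j 0)) ->
  (forall w, is_oracle X (response X beta eps w) beta (bo w)) ->
  measurable [set w | bhat w = bo w].
Proof.
move=> g0 mbhat or_bo; have [L LE] := oracle_linear n_gt0 X_norm g0.
have mbo j : measurable_fun setT (fun w => bo w j 0).
  under eq_fun => w do rewrite (LE _ _ (or_bo w)) mxE.
  apply: measurable_sum => i; apply: measurable_funM => //.
  under eq_fun do rewrite !mxE.
  exact: measurable_funD.
have -> : [set w | bhat w = bo w] =
    \bigcap_(j in [set: 'I_p]) ((fun w => bhat w j 0 - bo w j 0) @^-1` [set 0]).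
  apply/seteqP; split => [w /= bw j _ /=|w /= h].
    by rewrite bw subrr.
  by apply/colP => j; apply/eqP; rewrite -subr_eq0; apply/eqP; exact: h.
apply: fin_bigcap_measurable => // j _.
rewrite -[_ @^-1` _]setTI; apply: measurable_funB => //.
Qed.

Lemma oracle_prob_ge (lam tau a b : R) (pen J : R -> R -> R)
    (bhat1 bhat bo : T -> 'cV[R]_p) :
  let kappa := tau * re_const X beta ^- 2 * #|active_set beta|%:R in
  0 < re_const X beta -> 0 < lam -> 0 < tau ->
  regular_penalty pen J a b ->
  12 * kappa <= b -> 48 * kappa <= 1 -> 2 * tau <= 1 ->
  (a + 1) * lam <= dmin beta ->
  (forall w, is_calibrated_cccp J X (response X beta eps w) tau lam
    (bhat1 w) (bhat w)) ->
  (forall j, measurable_fun setT (fun w => bhat w j 0)) ->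
  (forall w, is_oracle X (response X beta eps w) beta (bo w)) ->
  ((1 - 2 * p%:R * expR (- (n%:R * tau ^+ 2 * lam ^+ 2) / (8 * sigma ^+ 2)))%:E
   <= P [set w | bhat w = bo w])%E.
Proof.
move=> kappa g0 lam_gt0 tau_gt0 pen_reg kb k1 t1 beta_min cccp mbhat or_bo.
have n0 : 0 < n%:R :> R by rewrite ltr0n.
have s0 : 0 < n%:R * tau * lam / 2 by rewrite divr_gt0 ?mulr_gt0.
have [] := large_noise_prob s0; set E := \big[_/_]_j _ => mE.
have -> : - (n%:R * tau * lam / 2) ^+ 2 / (2 * sigma ^+ 2 * n%:R) =
    - (n%:R * tau ^+ 2 * lam ^+ 2) / (8 * sigma ^+ 2).
  by field; rewrite !gt_eqF.
move=> PE; apply: (@le_trans _ _ (P (~` E))).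
  by rewrite probability_setC// EFinB leeB.
apply: le_measure; rewrite ?inE//; first exact: measurableC.
  exact: measurable_eq_oracle.
move=> w /= Ew.
apply: (cccp_eq_oracle n_gt0 X_norm g0 lam_gt0 tau_gt0 _ pen_reg kb k1 t1
  beta_min (cccp w) (or_bo w)).
move=> j; rewrite leNgt; apply/negP => jlarge; apply: Ew.
rewrite /E -bigcup_seq; exists j; first by rewrite /= mem_index_enum.
apply: ltW; congr (_ < `|_|): jlarge; rewrite mxE.
by apply: eq_bigr => i _; rewrite !mxE.
Qed.

End fixed_sample_size.

(** * Asymptotics in the sample size *)

(** Eventually [ln p <= m / (2 c)], so half of the exponent absorbs [p] and [expR (- m / (2 c))]
    remains as a bound. *)
Lemma exp_tail_cvg0 (R : realType) (c : R) (p : nat -> nat) (m : nat -> R) :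
  0 < c -> m @ \oo --> +oo -> (fun n => ln (p n)%:R : R) =o_\oo m ->
  (p n)%:R * expR (- (m n) / c) @[n --> \oo] --> (0 : R).
Proof.
move=> c0 mcvg /eqoP/(_ (2 * c)^-1); rewrite invr_gt0 mulr_gt0// => /(_ isT) lnp.
apply: (@squeeze_cvgr _ _ _ _ (cst 0) (fun n => expR (- ((2 * c)^-1 * m n)))).
- have m0 : \forall n \near \oo, 0 <= m n by move/cvgryPge : mcvg; exact.
  near=> n; rewrite mulr_ge0 ?expR_ge0//=.
  (* [p n = 0] is treated apart, as [expR (ln p)] recovers [p] only for positive [p]. *)
  have [->|pn0] := posnP (p n); first by rewrite mul0r expR_ge0.
  rewrite -[X in X * _]lnK ?posrE ?ltr0n// -expRD ler_expR.
  have mn0 : 0 <= m n by near: n.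
  have : `|ln (p n)%:R| <= (2 * c)^-1 * `|m n| by near: n.
  rewrite (ger0_norm mn0) invfM => /(le_trans (ler_norm _)); lra.
- exact: cvg_cst.
- have c1 : 0 < (2 * c)^-1 by rewrite invr_gt0 mulr_gt0.
  have scale_cvg : (2 * c)^-1 * m n @[n --> \oo] --> +oo.
    exact: (cvg_comp _ _ mcvg (gt0_cvgMry c1 cvg_id)).
  exact: (cvg_comp _ _ scale_cvg (@cvgr_expR R)).
Unshelve. all: by end_near. Qed.


Lemma dmin_ge0 (R : realType) p (beta : 'cV[R]_p) : 0 <= dmin beta.
Proof.
rewrite /dmin; set S := [set _ | _ in _].
have [->|/set0P S0] := eqVneq S set0; first by rewrite inf0.
by apply: lb_le_inf => // _ [j _ <-].
Qed.

Theorem theorem3p2 (R : realType)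
    (d : nat -> measure_display) (T : forall n : nat, measurableType (d n))
    (P : forall n : nat, probability (T n) R)
    (p : nat -> nat) (X : forall n : nat, 'M[R]_(n, p n))
    (beta : forall n : nat, 'cV[R]_(p n))
    (eps : forall n : nat, 'I_n -> {RV (P n) >-> R})
    (lam tau : nat -> R) (pen J : R -> R -> R)
    (sigma C1 a0 a b : R)
    (bhat1 bhat boracle : forall n : nat, T n -> 'cV[R]_(p n)) :
  (forall n, (0 < n)%N -> normalized_columns (X n)) ->
  (forall n, (0 < n)%N -> 0 < lam n) ->
  (forall n, (0 < n)%N -> 0 < tau n) ->
  0 < a0 -> standardized_penalty pen a0 ->
  0 < C1 ->
  (forall n, (0 < n)%N ->
    let XA := subcols (active_set (beta n)) (X n) in
    C1 <= lambda_min (n%:R^-1 *: (XA^T *m XA))) ->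
  0 < sigma ->
  (forall n, (0 < n)%N -> iid_subgaussian (eps n) sigma) ->
  regular_penalty pen J a b ->
  (forall n, (0 < n)%N -> 0 < re_const (X n) (beta n)) ->
  lam =o_\oo (fun n => dmin (beta n)) ->
  tau =o_\oo (fun _ => 1 : R) ->
  (fun n => tau n * re_const (X n) (beta n) ^- 2 * #|active_set (beta n)|%:R)
    =o_\oo (fun _ => 1 : R) ->
  (* estimators; the minimizers need not be unique, so [bhat] is any
     measurable selection *)
  (forall n, (0 < n)%N -> forall w : T n,
    let y := response (X n) (beta n) (eps n) w in
    is_calibrated_cccp J (X n) y (tau n) (lam n) (bhat1 n w) (bhat n w)) ->
  (forall n, (0 < n)%N -> forall j : 'I_(p n),
    measurable_fun [set: T n] (fun w => bhat n w j 0)) ->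
  (forall n, (0 < n)%N -> forall w : T n,
    let y := response (X n) (beta n) (eps n) w in
    is_oracle (X n) y (beta n) (boracle n w)) ->
  (\forall n \near \oo,
    ((1 - 8 * (p n)%:R
          * expR (- (n%:R * tau n ^+ 2 * lam n ^+ 2) / (8 * sigma ^+ 2)))%:E
     <= P n [set w | bhat n w = boracle n w])%E)
  /\
  ((fun n => n%:R * tau n ^+ 2 * lam n ^+ 2) @ \oo --> +oo ->
   (fun n => ln (p n)%:R) =o_\oo (fun n => n%:R * tau n ^+ 2 * lam n ^+ 2) ->
   (fun n => P n [set w | bhat n w = boracle n w]) @ \oo --> 1%E).

Proof.
move=> X_norm lam_gt0 tau_gt0 _ _ _ _ sigma_gt0 eps_sg pen_reg g0.
move=> /eqoP lam_o /eqoP tau_o /eqoP kappa_o cccp mbhat or_bo.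
have [a_gt1 b_gt0 _ _] := pen_reg.
pose m n := n%:R * tau n ^+ 2 * lam n ^+ 2.
(* Both claims follow from this bound with constant 2: the first since [2 <= 8], the second by
   squeezing between it and 1. *)
have bound : \forall n \near \oo,
    ((1 - 2 * (p n)%:R * expR (- m n / (8 * sigma ^+ 2)))%:E
     <= P n [set w | bhat n w = boracle n w])%E.
  have a1 : 0 < (a + 1)^-1 by rewrite invr_gt0 addr_gt0// (lt_trans _ a_gt1).
  (* The little-o hypotheses are instantiated at the thresholds of [cccp_eq_oracle]. *)
  have c0 : 0 < Num.min (b / 12) (48^-1) by rewrite lt_min divr_gt0//= invr_gt0.
  have half : 0 < 2^-1 :> R by rewrite invr_gt0.
  have kappa_small := kappa_o _ c0; have tau_small := tau_o _ half.
  have lam_small := lam_o _ a1.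
  near=> n.
  have n_gt0 : (0 < n)%N by near: n; exact: nbhs_infty_gt.
  have : `|lam n| <= (a + 1)^-1 * `|dmin (beta n)| by near: n.
  rewrite !ger0_norm ?dmin_ge0 ?(ltW (lam_gt0 _ n_gt0))// => lam_le.
  have : `|tau n| <= 2^-1 * `|1 : R| by near: n.
  rewrite normr1 mulr1 => /(le_trans (ler_norm _)) tau_le.
  have : `|tau n * re_const (X n) (beta n) ^- 2 * #|active_set (beta n)|%:R|
      <= Num.min (b / 12) (48^-1) * `|1 : R| by near: n.
  rewrite normr1 mulr1 => /(le_trans (ler_norm _)); rewrite le_min => /andP[kb k48].
  apply: (oracle_prob_ge n_gt0 (X_norm _ n_gt0) sigma_gt0 (eps_sg _ n_gt0)
    (g0 _ n_gt0) (lam_gt0 _ n_gt0) (tau_gt0 _ n_gt0) pen_reg _ _ _ _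
    (cccp _ n_gt0) (mbhat _ n_gt0) (or_bo _ n_gt0)); [lra|lra|lra|].
  rewrite -ler_pdivlMl//; by rewrite addr_gt0// (lt_trans _ a_gt1).
split.
  near=> n; apply: le_trans (near bound n _) => //.
  by rewrite lee_fin lerD2l lerN2 ler_wpM2r ?expR_ge0// ler_wpM2r// ler_nat.
move=> mcvg lnp.
have c0 : 0 < 8 * sigma ^+ 2 by rewrite mulr_gt0// exprn_gt0.
have tail0 := exp_tail_cvg0 c0 mcvg lnp.
apply: (squeeze_cvge
  (f := fun n => (1 - 2 * (p n)%:R * expR (- m n / (8 * sigma ^+ 2)))%:E)
  (h := cst 1%E)).
- near=> n; apply/andP; split; first by near: n.
  have n_gt0 : (0 < n)%N by near: n; exact: nbhs_infty_gt.
  apply: probability_le1.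
  exact: (measurable_eq_oracle n_gt0 (X_norm _ n_gt0) (g0 _ n_gt0)
    (mbhat _ n_gt0) (or_bo _ n_gt0)).
- apply: cvg_EFin; first by near=> n.
  rewrite -[X in _ --> X]subr0 -[X in _ - X](mulr0 2).
  apply: cvgB; first exact: cvg_cst.
  under eq_fun do rewrite -mulrA.
  exact: cvgMr tail0.
- exact: cvg_cst.
Unshelve. all: by end_near. Qed.
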